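(* Let $k\geq 2$ and let $n,p\geq 0$ be integers. The number of maximal hypercubes of dimension $p$ in the Munarini graph $M_{n,k}$ is $$h_p(M_{n,k})=(k-1)^{2p-n}\binom{p}{n-p}.$$
   Context: For integers $k\geq 1$, $n\geq 0$, a $k$-generalized Pell string of length $n$ is a word of length $n$ over the alphabet $\{0,1,\ldots,k\}$ in which every maximal run of the character $k$ has even length (equivalently, a concatenation of letters from $\{0,1,\ldots,k-1,kk\}$). Let $\mathcal{F}_{n,k}$ be the set of these strings (for $n=0$ it contains only the empty string). The Munarini graph $M_{n,k}$ is the simple graph with vertex set $\mathcal{F}_{n,k}$ in which two vertices are adjacent if one of them can be obtained from the other either by replacing one occurrence of $0$ with some $i\in\{1,\ldots,k-1\}$, or by replacing one substring $00$ (two consecutive positions) with $kk$ (both replacements may be read in either direction, and both strings must be in $\mathcal{F}_{n,k}$). A maximal hypercube of a graph $G$ is an induced subgraph of $G$ isomorphic to a hypercube $Q_p$ for some $p\geq 0$ ($Q_0=K_1$) that is not contained in a larger induced hypercube of $G$; $h_p(G)$ is the number of maximal hypercubes of dimension $p$ of $G$. Convention: $\binom{p}{n-p}=0$ if $n-p<0$ or $n-p>p$ (so the right-hand side is $0$ when $p<n/2$ or $p>n$). *)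

(* Defs.v *)
From mathcomp Require Import all_boot all_order all_algebra.

Set Implicit Arguments.
Unset Strict Implicit.
Unset Printing Implicit Defensive.

Record sgraph := SGraph {
  svertex :> finType;
  sedge : rel svertex;
  sedge_sym : symmetric sedge;
  sedge_irrefl : irreflexive sedge
}.

Definition induces (G H : sgraph) (S : {set G}) : bool :=
  [exists f : {ffun H -> G},
    [&& injectiveb f,
        f @: [set: H] == S
      & [forall x, forall y, sedge (f x) (f y) == sedge x y]]].

Section Hypercube.
Variable p : nat.

Definition hypercube_adj (x y : p.-tuple bool) : bool :=
  #|[set i | tnth x i != tnth y i]| == 1.

Lemma hypercube_adj_sym : symmetric hypercube_adj.
Proof.
by move=> x y; congr (_ == _); apply: eq_card => i; rewrite !inE eq_sym.
Qed.

Lemma hypercube_adj_irrefl : irreflexive hypercube_adj.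
Proof.
move=> x; rewrite /hypercube_adj (_ : [set _ | _] = set0) ?cards0 //.
by apply/setP=> i; rewrite !inE eqxx.
Qed.

Definition hypercube : sgraph := SGraph hypercube_adj_sym hypercube_adj_irrefl.

End Hypercube.

(* A set inducing Q_q has 2 ^ q > q elements, so bounding q by #|S| loses
   nothing; see induces_hypercubeP. *)
Definition induces_hypercube (G : sgraph) (S : {set G}) : bool :=
  [exists q : 'I_#|S|, induces (hypercube q) S].

Lemma card_induces_hypercube (G : sgraph) (S : {set G}) (q : nat) :
  induces (hypercube q) S -> #|S| = 2 ^ q.
Proof.
case/existsP=> f /and3P[/injectiveP f_inj /eqP <- _].
by rewrite card_imset // cardsT card_tuple card_bool.
Qed.

Lemma induces_hypercubeP (G : sgraph) (S : {set G}) :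
  reflect (exists q, induces (hypercube q) S) (induces_hypercube S).
Proof.
apply: (iffP existsP) => [[q Sq]|[q Sq]]; first by exists q.
have lt_qS : q < #|S| by rewrite (card_induces_hypercube Sq) ltn_expl.
by exists (Ordinal lt_qS).
Qed.

Definition maximal_hypercubes (G : sgraph) (p : nat) : {set {set G}} :=
  [set S | induces (hypercube p) S
         & ~~ [exists T : {set G}, (S \proper T) && induces_hypercube T]].

Definition num_maximal_hypercubes (G : sgraph) (p : nat) : nat :=
  #|maximal_hypercubes G p|.

Section Munarini.
Variables n k : nat.

(* Words have letters in 'I_k.+1 = {0, ..., k}; the letter k is ord_max. *)
Implicit Types w : n.-tuple 'I_k.+1.

(* The positions i, ..., j (both included) form a maximal run of the letter k. *)
Definition maximal_run w (i j : 'I_n) : bool :=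
  [&& i <= j,
      [forall l : 'I_n, (i <= l <= j) ==> (tnth w l == ord_max)],
      [forall l : 'I_n, (l.+1 == i) ==> (tnth w l != ord_max)]
    & [forall l : 'I_n, (l == j.+1 :> nat) ==> (tnth w l != ord_max)]].

Definition is_pell_string w : bool :=
  [forall i, forall j, maximal_run w i j ==> ~~ odd (j - i).+1].

Definition pell_string := {w : n.-tuple 'I_k.+1 | is_pell_string w}.

Definition replace_letter w w' : bool :=
  [exists j : 'I_n,
    [&& tnth w j == ord0, 1 <= tnth w' j <= k - 1
      & [forall l, (l != j) ==> (tnth w' l == tnth w l)]]].

Definition replace_pair w w' : bool :=
  [exists j : 'I_n, exists j' : 'I_n,
    [&& j' == j.+1 :> nat,
        tnth w j == ord0, tnth w j' == ord0,
        tnth w' j == ord_max, tnth w' j' == ord_max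
      & [forall l, (l != j) && (l != j') ==> (tnth w' l == tnth w l)]]].

Definition replacement w w' : bool := replace_letter w w' || replace_pair w w'.

(* The condition u != v matters only for k = 0, where ord0 = ord_max. *)
Definition munarini_adj (u v : pell_string) : bool :=
  (u != v) && (replacement (val u) (val v) || replacement (val v) (val u)).

Lemma munarini_adj_sym : symmetric munarini_adj.
Proof. by move=> u v; rewrite /munarini_adj eq_sym orbC. Qed.

Lemma munarini_adj_irrefl : irreflexive munarini_adj.
Proof. by move=> u; rewrite /munarini_adj eqxx. Qed.

Definition munarini : sgraph := SGraph munarini_adj_sym munarini_adj_irrefl.

End Munarini.

(* Binomial coefficient with an integer lower index, zero when it is negative. *)
Definition binz (p : nat) (q : int) : nat :=
  if q is Posz m then 'C(p, m) else 0.

(* Main.v *)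
Require Import Defs.
From mathcomp Require Import all_boot all_order all_algebra.
From mathcomp Require Import zify.

Set Implicit Arguments.
Unset Strict Implicit.
Unset Printing Implicit Defensive.

(** Cutting a Pell string into nonzero letters < k and blocks kk, and forgetting
    the zeros, turns it into a set of pairwise disjoint placed pieces.  These
    sets form a simplicial complex, and two strings are adjacent when their
    sets differ by one piece.  In such a graph every induced hypercube has a
    largest vertex containing all its other vertices, so it lies in the Boolean
    lattice of subfaces of that vertex; hence the maximal hypercubes of
    dimension p are the subface lattices of the facets with p elements.  Since
    k >= 2, the facets are the strings without zeros, and those with p pieces
    are sequences of p pieces of which n - p are blocks kk. *)

(** * Induced hypercubes in the face graph of a simplicial complex *)

Section FaceGraph.
Variables (G : sgraph) (T : finType) (face : G -> {set T}).
Hypothesis face_inj : injective face.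
Hypothesis face_down : forall v (X : {set T}),
  X \subset face v -> exists u, face u = X.
Hypothesis sedge_face : forall u v,
  sedge u v = (#|(face u :\: face v) :|: (face v :\: face u)| == 1).

Definition subfaces (v : G) : {set G} := [set u | face u \subset face v].

Lemma subfaces_inj : injective subfaces.
Proof.
move=> u v /setP e; apply/face_inj/eqP; rewrite eqEsubset.
by have := e u; have := e v; rewrite !inE !subxx => -> <-.
Qed.

(** Indicator vectors identify subsets of [face v] with cube vertices, [face_down] realizes each
    subset as a face, and a symmetric difference has the Hamming distance as its size. *)
Lemma induces_subfaces v : induces (hypercube #|face v|) (subfaces v).
Proof.
pose g (x : #|face v|.-tuple bool) := [set enum_val i | i : 'I_#|face v| & tnth x i].
have gE x i : (enum_val i \in g x) = tnth x i.
  apply/imsetP/idP => [[j + /enum_val_inj->]|xi]; first by rewrite inE.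
  by exists i => //; rewrite inE.
have g_sub x : g x \subset face v.
  by apply/subsetP=> _ /imsetP[i _ ->]; exact: enum_valP.
have gP (X : {set T}) : X \subset face v -> X = g [tuple enum_val i \in X | i < #|face v|].
  move=> sXv; apply/setP=> t; apply/idP/imsetP => [tX|[i]].
    exists (enum_rank_in (subsetP sXv t tX) t); last by rewrite enum_rankK_in ?(subsetP sXv).
    by rewrite inE tnth_mktuple enum_rankK_in ?(subsetP sXv).
  by rewrite inE tnth_mktuple => ? ->.
(* The default [v] is never taken: [fE] finds a suitable vertex by [face_down]. *)
pose f (x : hypercube #|face v|) : G := odflt v [pick u | face u == g x].
have fE x : face (f x) = g x.
  rewrite /f; case: pickP => [u /eqP//|no].
  by have [u eu] := face_down (g_sub x); move: (no u); rewrite eu eqxx.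
apply/existsP; exists (finfun f); apply/and3P; split.
- apply/injectiveP=> x y; rewrite !ffunE => /(congr1 face); rewrite !fE => e.
  by apply: eq_from_tnth => i; rewrite -!gE e.
- apply/eqP/setP=> u; rewrite inE; apply/imsetP/idP => [[x _ ->]|su].
    by rewrite ffunE fE.
  exists [tuple enum_val i \in face u | i < #|face v|] => //.
  by apply: face_inj; rewrite ffunE fE -gP.
- apply/forallP=> x; apply/forallP=> y; rewrite !ffunE sedge_face !fE.
  rewrite /= /hypercube_adj; apply/eqP; congr (_ == _).
  rewrite -(card_imset _ (@enum_val_inj _ (mem (face v)))).
  apply: eq_card => t; apply/idP/imsetP => [|[i]].
    move=> tg; have tv : t \in face v.
      by move: tg; rewrite !inE => /orP[]/andP[_]; apply/subsetP/g_sub.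
    move: tg; rewrite -(enum_rankK_in tv tv); set i := enum_rank_in _ _ => tg.
    exists i => //; move: tg; rewrite !inE !gE.
    by case: (tnth x _); case: (tnth y _).
  by rewrite inE => + ->; rewrite !inE !gE; case: (tnth x _); case: (tnth y _).
Qed.

Lemma sedge_face_sub u v : sedge u v -> (face u \subset face v) || (face v \subset face u).
Proof.
rewrite sedge_face => /cards1P[t /setP et].
have [tu|tu] := boolP (t \in face u); apply/orP; [right|left]; apply/subsetP => s;
  move: (et s); rewrite !inE; case: eqP => [->|_]; rewrite ?tu ?(negPf tu) //;
  by case: (s \in face v); case: (s \in face u).
Qed.

(* A vertex x of the cube that violates the inclusion and differs from the
   largest one in two coordinates has two neighbours closer to it; both must be
   x minus the same element of T, so they coincide. *)
Lemma hypercube_top q (S : {set G}) : induces (hypercube q) S ->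
  exists2 t, t \in S & S \subset subfaces t.
Proof.
case/existsP=> f /and3P[/injectiveP f_inj /eqP <- /forallP adj].
have {}adj x y : sedge (f x) (f y) = hypercube_adj x y by move/forallP: (adj x) => /(_ y)/eqP.
(* The constant tuple only witnesses that the cube has a vertex. The induction below is on the
   Hamming distance to [x0]. *)
have [x0 _ x0max] := @arg_maxnP _ [tuple of nseq q false] predT (fun x => #|face (f x)|) isT.
exists (f x0); first by rewrite imset_f.
suff sub d x : #|[set i | tnth x i != tnth x0 i]| = d -> face (f x) \subset face (f x0).
  by apply/subsetP=> _ /imsetP[x _ ->]; rewrite inE; apply: sub.
elim: d x => [|d IH] x dx.
  suff -> : x = x0 by [].
  apply: eq_from_tnth => i; apply/eqP; apply: contraT => ne.
  by move/eqP: dx; rewrite cards_eq0 => /eqP/setP/(_ i); rewrite !inE ne.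
pose flip i := [tuple if j == i then tnth x0 j else tnth x j | j < q] : hypercube q.
have flipP i : tnth x i != tnth x0 i ->
    hypercube_adj x (flip i) /\ face (f (flip i)) \subset face (f x0).
  move=> ne; split.
    apply/cards1P; exists i; apply/setP=> j; rewrite !inE tnth_mktuple.
    by have [->|_] := eqVneq j i; rewrite ?ne ?eqxx.
  apply: IH; move: dx; rewrite (cardsD1 i) inE ne => -[<-].
  by apply: eq_card => j; rewrite !inE tnth_mktuple; have [->|_] := eqVneq j i; rewrite ?eqxx.
have [i nei] : exists i, tnth x i != tnth x0 i.
  have /card_gt0P[i] : 0 < #|[set i | tnth x i != tnth x0 i]| by rewrite dx.
  by rewrite inE; exists i.
have [adji subi] := flipP i nei.
case: d => [|d] in dx IH *.
  have xi : flip i = x0.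
    apply: eq_from_tnth => j; rewrite tnth_mktuple; case: eqP => // /eqP nej.
    apply/eqP; apply: contraT => ne; move: dx.
    by rewrite (cardsD1 i) (cardsD1 j) !inE nei ne nej.
  (* At distance one the two faces are nested, and the choice of [x0] turns the wrong inclusion into
     an equality. *)
  move: adji; rewrite xi -adj => /sedge_face_sub/orP[//|s].
  have /eqP-> // : face (f x0) == face (f x).
  by rewrite eqEcard s; apply: x0max.
have [j nej ji] : exists2 j, tnth x j != tnth x0 j & j != i.
  have /card_gt0P[j] : 0 < #|[set i | tnth x i != tnth x0 i] :\ i|.
    suff [->] : #|[set i | tnth x i != tnth x0 i] :\ i|.+1 = d.+2 by [].
    by rewrite -dx [RHS](cardsD1 i) inE nei.
  by rewrite !inE => /andP[]; exists j.
have [adjj subj] := flipP j nej.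
apply: contraT => /subsetPn[t tx tx0].
have key l : hypercube_adj x (flip l) -> face (f (flip l)) \subset face (f x0) ->
    face (f (flip l)) = face (f x) :\ t.
  rewrite -adj sedge_face => /cards1P[s es] sub.
  have tl : t \notin face (f (flip l)) by apply: contra tx0; apply/subsetP.
  have : t \in [set s] by rewrite -es !inE tx tl.
  rewrite inE => /eqP ets; move/setP: es; rewrite -ets => es.
  apply/setP=> r; move: (es r); rewrite !inE; case: eqP => [->|_] /=.
    by rewrite (negPf tl).
  by case: (r \in _); case: (r \in _).
have /f_inj/(congr1 (fun y => tnth y i)) : f (flip i) = f (flip j).
  by apply: face_inj; rewrite (key i) // (key j).
by rewrite !tnth_mktuple eqxx eq_sym (negPf ji) => e; rewrite e eqxx in nei.
Qed.

Definition facet v := [forall u, (face v \subset face u) ==> (u == v)].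

(** A maximal cube fills the cube [subfaces t] of its top [t], and a face larger than [face t] would
    give a larger cube. Conversely, when [t] is a facet, the top of any cube containing [subfaces t]
    is [t] itself. *)
Lemma maximal_hypercubesE p :
  maximal_hypercubes G p = subfaces @: [set v | facet v & #|face v| == p].
Proof.
apply/setP=> S; rewrite inE; apply/andP/imsetP.
  case=> Sp /existsPn Smax; have [t tS St] := hypercube_top Sp.
  have eS : S = subfaces t.
    apply/eqP; rewrite eqEproper St /=.
    apply: contraNN (Smax (subfaces t)) => ->; apply/induces_hypercubeP.
    by exists #|face t|; apply: induces_subfaces.
  exists t => //; rewrite inE; apply/andP; split.
    apply/forallP=> u; apply/implyP=> tu.
    apply: contraT => nut; case/negP: (Smax (subfaces u)).
    apply/andP; split; last first.
      by apply/induces_hypercubeP; exists #|face u|; apply: induces_subfaces.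
    rewrite eS; apply/properP; split.
      by apply/subsetP=> w; rewrite !inE => /subset_trans->.
    exists u; rewrite inE //; apply: contra nut => ut.
    by apply/eqP/face_inj/eqP; rewrite eqEsubset ut.
  (* The dimension is read off from the cardinality [2 ^ p]. *)
  move: (card_induces_hypercube Sp); rewrite eS.
  by rewrite (card_induces_hypercube (induces_subfaces t)) => /eqP; rewrite eqn_exp2l.
case=> t; rewrite inE => /andP[/forallP tmax /eqP <-] ->.
split; first exact: induces_subfaces.
apply/existsPn=> C; apply/negP=> /andP[/properP[tC [c cC ct]]].
case/induces_hypercubeP=> q /hypercube_top[u uC Cu].
have tu : face t \subset face u.
  by have := subsetP Cu t (subsetP tC t _); rewrite !inE; apply.
move: (tmax u); rewrite tu => /eqP eut.
by case/negP: ct; rewrite -eut; apply: (subsetP Cu).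
Qed.

Lemma num_maximal_hypercubesE p :
  num_maximal_hypercubes G p = #|[set v | facet v & #|face v| == p]|.
Proof.
by rewrite /num_maximal_hypercubes maximal_hypercubesE card_imset //; apply: subfaces_inj.
Qed.

End FaceGraph.

(** * Pell strings described by the parity of the letters k in prefixes *)

Section PellParity.
Variables (k : nat) (k_gt0 : 0 < k).
Implicit Types s : seq 'I_k.+1.

(** In a Pell string, an odd value says that position [m] is the second half of a block kk. *)
Definition parity s m := odd (count_mem ord_max (take m s)).

(* The out-of-range letter ord0 differs from ord_max, so that no bounds on
   positions are needed below. *)
Lemma ord0_neq_max : (ord0 == ord_max :> 'I_k.+1) = false.
Proof. by rewrite -val_eqE /=; lia. Qed.

Lemma nth_max_lt s m : nth ord0 s m = ord_max -> m < size s.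
Proof.
by case: ltnP => // /(nth_default ord0)-> /eqP; rewrite ord0_neq_max.
Qed.

Lemma parity0 s : parity s 0 = false.
Proof. by rewrite /parity take0. Qed.

Lemma parityS s m : parity s m.+1 = parity s m (+) (nth ord0 s m == ord_max).
Proof.
rewrite /parity; case: (ltnP m (size s)) => ms.
  by rewrite (take_nth ord0 ms) -cats1 count_cat oddD /= addn0 oddb.
rewrite nth_default // ord0_neq_max addbF !take_oversize //; lia.
Qed.

Lemma parity_cons x s m :
  parity (x :: s) m.+1 = (x == ord_max) (+) parity s m.
Proof. by rewrite /parity /= oddD oddb. Qed.

(** Half-open form of the run condition: the run may be empty, and [m] may be the end of the word,
    where the default letter stops the run. *)
Lemma pell_run_even n (w : n.-tuple 'I_k.+1) i m : is_pell_string w ->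
  i <= m -> (forall l, i <= l < m -> nth ord0 w l = ord_max) ->
  (forall l, l.+1 = i -> nth ord0 w l <> ord_max) ->
  nth ord0 w m <> ord_max -> ~~ odd (m - i).
Proof.
move=> wP; case: m => [|m] im run start stop; first by rewrite sub0n.
have [->|ltim] := eqVneq i m.+1; first by rewrite subnn.
have lei : i <= m by lia.
have mn : m < n by rewrite -(size_tuple w); apply: nth_max_lt; apply: run; lia.
have ni : i < n by lia.
move/forallP: wP => /(_ (Ordinal ni))/forallP/(_ (Ordinal mn))/implyP.
rewrite /= subSn //; apply; apply/and4P; split=> //.
- by apply/forallP=> l; apply/implyP=> /= H; rewrite (tnth_nth ord0) run //; lia.
- apply/forallP=> l; apply/implyP=> /= /eqP H; rewrite (tnth_nth ord0).
  by apply/eqP/start.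
- apply/forallP=> l; apply/implyP=> /= /eqP H; rewrite (tnth_nth ord0) H.
  exact/eqP.
Qed.

(** Forward, earlier runs are even, so the parity at [m] is that of the run ending just before [m].
    Backward, a letter other than k occurs only at even parity, so the parity is even at both ends
    of a maximal run. *)
Lemma pell_parityP n (w : n.-tuple 'I_k.+1) :
  reflect (forall m, parity w m -> nth ord0 w m = ord_max) (is_pell_string w).
Proof.
apply: (iffP idP) => [wP m|wP].
  (* Here [i] is where the run of letters k ending just before [m] starts, with [i = m] if there is
     none. *)
  have [i [im run start oddi]] : exists i,
      [/\ i <= m, forall l, i <= l < m -> nth ord0 w l = ord_max,
          forall l, l.+1 = i -> nth ord0 w l <> ord_max
        & parity w m = odd (m - i)].
    elim: m => [|m [i [im run start oddi]]].
      by exists 0; split; rewrite ?parity0 // => l; lia.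
    have [wm|/eqP wm] := eqVneq (nth ord0 w m) ord_max.
      exists i; split=> //; first lia.
        by move=> l H; have [->//|lm] := eqVneq l m; apply: run; lia.
      by rewrite parityS wm eqxx oddi subSn // addbT.
    exists m.+1; split=> //; first by move=> l; lia.
      by move=> l [->].
    rewrite parityS oddi (negPf (pell_run_even wP im run start wm)) subnn /=.
    exact/negbTE/eqP.
  move=> odd_m; apply/eqP; apply: contraT => /eqP wm.
  by move: (pell_run_even wP im run start wm); rewrite -oddi odd_m.
apply/forallP=> i; apply/forallP=> j; apply/implyP.
case/and4P=> ij /forallP run /forallP start /forallP stop.
have stop' m : nth ord0 w m != ord_max -> parity w m = false.
  by move=> ne; apply: contraNF ne => /wP->.
have par_i : parity w i = false.
  case: i start {ij run} => [[|i] ltin] /= start; first exact: parity0.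
  have ltin' : i < n by lia.
  have := start (Ordinal ltin'); rewrite /= eqxx (tnth_nth ord0) /= => ne.
  by rewrite parityS stop' // (negPf ne).
have par d : i + d <= j.+1 -> parity w (i + d) = odd d.
  elim: d => [|d IH] H; first by rewrite addn0.
  have lt : i + d < n by have := ltn_ord j; lia.
  rewrite addnS parityS IH; last lia.
  have := run (Ordinal lt); rewrite (tnth_nth ord0) /=.
  by rewrite (_ : (i <= i + d <= j)) /=; [move=> ->; rewrite addbT|lia].
have ij' : i <= j.+1 by lia.
rewrite -subSn //; have := par (j.+1 - i); rewrite (subnKC ij') => <- //; rewrite stop' //.
(* For a run reaching the end of the word, the default [ord0] acts as the stopping letter. *)
case: (ltnP j.+1 n) => jn; last by rewrite nth_default ?size_tuple // ord0_neq_max.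
by have := stop (Ordinal jn); rewrite /= eqxx (tnth_nth ord0).
Qed.

Lemma pell_parity_max n (w : n.-tuple 'I_k.+1) m :
  is_pell_string w -> parity w m -> nth ord0 w m = ord_max.
Proof. by move=> /pell_parityP; apply. Qed.

(** Automaton form of the parity criterion: [b] records a half-read block kk, which must be
    completed before the word ends. *)
Fixpoint pell_from (b : bool) s :=
  if s is x :: s' then (b ==> (x == ord_max)) && pell_from (b (+) (x == ord_max)) s'
  else ~~ b.

Lemma pell_fromP b s :
  reflect (forall m, b (+) parity s m -> nth ord0 s m = ord_max) (pell_from b s).
Proof.
elim: s b => [|x s IH] b /=.
  apply: (iffP idP) => [/negPf-> m|/(_ 0)]; first by rewrite /parity /=.
  by rewrite parity0 addbF; case: b => // /(_ isT)/eqP; rewrite ord0_neq_max.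
apply: (iffP andP) => [[bx /IH sP] [|m]|sP].
- by rewrite parity0 addbF /= => bT; rewrite bT in bx; apply/eqP.
- by rewrite parity_cons addbA; apply: sP.
split; first by apply/implyP=> bT; apply/eqP/(sP 0); rewrite parity0 bT.
by apply/IH=> m; rewrite -addbA -parity_cons => /sP.
Qed.

(** Counts pieces rather than letters: a letter k contributes only when it opens a block. *)
Fixpoint rank_from (b : bool) s : nat :=
  if s is x :: s' then
    ((x != ord0) && ((x == ord_max) ==> ~~ b)) + rank_from (b (+) (x == ord_max)) s'
  else 0.

Lemma rank_fromE b s : rank_from b s =
  \sum_(i < size s)
     ((nth ord0 s i != ord0) && ((nth ord0 s i == ord_max) ==> ~~ (b (+) parity s i))).
Proof.
elim: s b => [|x s IH] b /=; first by rewrite big_ord0.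
rewrite big_ord_recl /= parity0 addbF IH; congr (_ + _).
by apply: eq_bigr => i _; rewrite /bump /= parity_cons addbA.
Qed.

(** * Enumeration and count of the zero-free Pell words *)

Definition small_letters := [seq a <- enum 'I_k.+1 | (a != ord0) && (a != ord_max)].

(** Lists words with [p] pieces and length [n] by their first piece: a small letter takes one
    position, a block two. *)
Fixpoint full_words p n : seq (seq 'I_k.+1) :=
  match p, n with
  | 0, 0 => [:: [::]]
  | p'.+1, n'.+1 =>
    [seq a :: s | a <- small_letters, s <- full_words p' n'] ++
    (if n' is n''.+1 then [seq ord_max :: ord_max :: s | s <- full_words p' n''] else [::])
  | _, _ => [::]
  end.

(** By the first letter: zero is excluded, a small letter keeps the state [false], and a k forces a
    second k, which restores that state. *)
Lemma mem_full_words p n s : (s \in full_words p n) =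
  [&& size s == n, pell_from false s, ord0 \notin s & rank_from false s == p].
Proof.
elim: p n s => [|p IH] [|n] s.
- case: s => [|x s]; by rewrite inE.
- case: s => [|x s] //=; rewrite inE /= [ord0 == x]eq_sym.
  by rewrite implybT andbT; case: (x == ord0); rewrite /= ?andbF // add1n !andbF.
- by case: s.
case: s => [|x s] /=.
  rewrite mem_cat; apply/orP=> -[/allpairsP[[? ?] []]//|].
  by case: n => // n /mapP[].
rewrite mem_cat implybT andbT inE negb_or [ord0 == x]eq_sym eqSS.
have [->|x0] := eqVneq x ord0.
  rewrite !andbF /=; apply/orP=> -[/allpairsP[[a t] [/= + _ [e _]]]|].
    by rewrite mem_filter -e eqxx.
  by case: n => // n /mapP[t _ /eqP]; rewrite eqseq_cons ord0_neq_max.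
have [->|xm] := eqVneq x ord_max; last first.
  rewrite /= add1n eqSS -IH.
  set Q := (X in _ || (_ \in X)); have /negPf-> : x :: s \notin Q.
    rewrite {}/Q; case: n => // n; apply/mapP=> -[t _ /eqP].
    by rewrite eqseq_cons (negPf xm).
  rewrite orbF; apply/allpairsP/idP => [[[a t] [/= _ tL [_ ->]]] //|sL].
  by exists (x, s); split=> //=; rewrite mem_filter x0 xm mem_enum.
rewrite /= add1n eqSS.
rewrite (_ : (_ \in [seq _ :: _ | _ <- _, _ <- _]) = false) /=; last first.
  apply/allpairsP=> -[[a t] [/= + _ [e _]]].
  by rewrite mem_filter -e eqxx andbF.
case: n => [|n]; first by case: s.
case: s => [|y s]; first by apply/mapP=> -[].
rewrite /= eqSS inE negb_or; have [->|ym] := eqVneq y ord_max.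
  rewrite ord0_neq_max andbF add0n /= -IH mem_map //.
  by move=> ? ? [].
by rewrite /= andbF; apply/mapP=> -[t _ /eqP]; rewrite !eqseq_cons (negPf ym) andbF.
Qed.

Lemma full_words_uniq p n : uniq (full_words p n).
Proof.
elim: p n => [|p IH] [|n] //=.
rewrite cat_uniq; apply/and3P; split.
- apply: allpairs_uniq => //; first by rewrite filter_uniq ?enum_uniq.
  by move=> [a s] [b t] _ _ /= [-> ->].
- apply/hasPn=> s; case: n => // n /mapP[t _ ->].
  apply/negP=> /allpairsP[[a u] [/= + _ [e _]]].
  by rewrite mem_filter -e eqxx andbF.
- case: n => // n; rewrite map_inj_uniq // => ? ? [].
  by [].
Qed.

Lemma size_small_letters : size small_letters = k.-1.
Proof.
rewrite size_filter; have := count_predC (predU1 ord0 (pred1 ord_max)) (enum 'I_k.+1).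
rewrite size_enum_ord (@eq_count _ (predC _) (fun a => (a != ord0) && (a != ord_max))); last first.
  by move=> a; rewrite /= negb_or.
rewrite -size_filter (_ : size _ = 2); first lia.
have u : uniq [:: ord0; ord_max : 'I_k.+1] by rewrite /= inE ord0_neq_max.
apply/eqP; rewrite -[2]/(size [:: ord0; ord_max : 'I_k.+1]); apply/eqP/perm_size/uniq_perm => //.
  by rewrite filter_uniq ?enum_uniq.
by move=> a; rewrite mem_filter mem_enum !inE andbT.
Qed.

(** Among [p] pieces, [n - p] are blocks and [2 * p - n] small letters; the recursion is Pascal's
    rule. The guard is needed because truncated subtraction would give ['C(p, 0)] when [n < p]. *)
Lemma size_full_words p n : size (full_words p n) =
  if p <= n then (k - 1) ^ (2 * p - n) * 'C(p, n - p) else 0.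
Proof.
elim: p n => [|p IH] [|n] //=.
rewrite size_cat size_allpairs size_small_letters IH ltnS subSS subn1.
have -> : 2 * p.+1 - n.+1 = (2 * p).+1 - n by lia.
case: n => [|n].
  by case: p {IH} => [|p] //=; rewrite ?addn0 ?muln0 // !bin0 !muln1 expn0 expn1 muln1.
rewrite size_map IH subSS; case: (ltngtP p n.+1) => pn; last 1 first.
- rewrite (_ : (p <= n) = false); last lia.
  rewrite -pn subnn !bin0 !muln1 addn0 -expnS; congr (_ ^ _); lia.
- rewrite (_ : (p <= n) = true); last lia.
  rewrite (_ : n.+1 - p = (n - p).+1); last lia.
  rewrite binS mulnDr; congr (_ + _); rewrite ?subn1 ?subSS //.
  (* The factor [k - 1] can be absorbed into the power only if [n < 2 * p]; otherwise the
     subtraction truncates, but the binomial vanishes. *)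
  case: (ltnP (n - p) p) => H.
    by rewrite mulnA -expnS; congr (_ ^ _ * _); lia.
  by rewrite bin_small ?muln0 //; lia.
- by rewrite (_ : (p <= n) = false) ?muln0 //; lia.
Qed.

End PellParity.

(** * Pell strings as sets of disjoint placed pieces *)

Section Tokens.
Variables (n k : nat) (k_gt1 : 1 < k).
Local Notation word := (n.-tuple 'I_k.+1).
Local Notation token := ('I_n * 'I_k.+1)%type.
Implicit Types (w : word) (X Y : {set token}) (u v : munarini n k).

Let k_gt0 : 0 < k := ltnW k_gt1.
Let ord0_max := ord0_neq_max k_gt0.

(* A token (j, a) stands for a letter 0 < a < k at position j, or for a block
   kk at positions j, j+1 when a = k; in a Pell string the letter k at j opens a
   block exactly when an even number of letters k precede it. *)
Definition tokens w : {set token} :=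
  [set t | [&& tnth w t.1 == t.2, t.2 != ord0 & (t.2 == ord_max) ==> ~~ parity w t.1]].

(** Marks the second position of a block. *)
Definition closes X (m : nat) := [exists j : 'I_n, (j.+1 == m) && ((j, ord_max) \in X)].

(** Inverse of [tokens] on compatible sets: the default [ord0] restores the forgotten zeros, and
    [closes] supplies the second k of a block, which has no token of its own. *)
Definition word_of X : word :=
  [tuple if closes X j then ord_max else odflt ord0 [pick a | (j, a) \in X] | j < n].

(** The pieces are nonzero, disjoint and inside the word. All clauses pass to subsets, whence a
    simplicial complex. *)
Definition compatible X :=
  [/\ forall j a, (j, a) \in X -> a != ord0,
      forall j a b, (j, a) \in X -> (j, b) \in X -> a = b,
      forall j, (j, ord_max) \in X -> j.+1 < n
    & forall j a, (j, a) \in X -> ~~ closes X j].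

Lemma closes0 X : closes X 0 = false.
Proof. by apply/existsP=> -[]. Qed.

Lemma closesS X (j : 'I_n) : closes X j.+1 = ((j, ord_max) \in X).
Proof.
apply/existsP/idP => [[i /andP[/eqP[/val_inj->]]]//|jX].
by exists j; rewrite eqxx.
Qed.

Lemma closes_ge X m : n < m -> closes X m = false.
Proof.
by move=> nm; apply/existsP=> -[j /andP[/eqP e _]]; have := ltn_ord j; lia.
Qed.

Lemma closes_sub X Y m : X \subset Y -> closes X m -> closes Y m.
Proof.
move=> /subsetP XY /existsP[j /andP[jm jX]].
by apply/existsP; exists j; rewrite jm XY.
Qed.

Lemma closes_lt X m : compatible X -> closes X m -> m < n.
Proof. by case=> _ _ H _ /existsP[j /andP[/eqP <- /H]]. Qed.

Lemma compatible_sub X Y : X \subset Y -> compatible Y -> compatible X.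
Proof.
move=> XY [Y0 YU Yn Yc]; have sub := subsetP XY; split.
- by move=> j a /sub/Y0.
- by move=> j a b /sub/YU H /sub/H.
- by move=> j /sub/Yn.
- by move=> j a /sub/Yc; apply: contra; apply: closes_sub.
Qed.

Lemma mem_word_of X j a : compatible X ->
  ((j, a) \in X) = [&& tnth (word_of X) j == a, a != ord0 & ~~ closes X j].
Proof.
move=> [X0 XU _ Xc]; rewrite tnth_mktuple; apply/idP/idP => [jX|].
  rewrite (X0 _ _ jX) (Xc _ _ jX) (negPf (Xc _ _ jX)) !andbT.
  by case: pickP => [b /XU/(_ jX)-> //|/(_ a)]; rewrite jX.
case: (closes X j); rewrite ?andbF // andbT.
case: pickP => [b jX /andP[/eqP<-]//|_ /andP[/eqP<-]].
by rewrite eqxx.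
Qed.

Lemma closes_word_of X (j : 'I_n) : closes X j -> tnth (word_of X) j = ord_max.
Proof. by rewrite tnth_mktuple => ->. Qed.

Lemma word_of_eq0 X (j : 'I_n) :
  ~~ closes X j -> (forall a, (j, a) \notin X) -> tnth (word_of X) j = ord0.
Proof.
move=> /negPf cj Xj; rewrite tnth_mktuple cj.
by case: pickP => // a; rewrite (negPf (Xj a)).
Qed.

(** A closing position carries a k that makes the parity even again; any other position carries a k
    only if it opens a block. *)
Lemma parity_word_of X m : compatible X -> parity (word_of X) m = closes X m.
Proof.
move=> Xc; elim: m => [|m IH]; first by rewrite parity0 closes0.
rewrite parityS // IH; have [mn|nm] := ltnP m n; last first.
  rewrite nth_default ?size_tuple // ord0_max addbF [RHS]closes_ge; last lia.
  by apply/negbTE/negP=> /(closes_lt Xc); lia.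
have [j ->] : exists j : 'I_n, m = j by exists (Ordinal mn).
rewrite closesS mem_word_of // -(tnth_nth ord0) [ord_max == _]eq_sym ord0_max /=.
by have [/closes_word_of->|_] := boolP (closes X j); rewrite ?eqxx ?andbF ?andbT.
Qed.

Lemma pell_word_of X : compatible X -> is_pell_string (word_of X).
Proof.
move=> Xc; apply/pell_parityP=> // m; rewrite parity_word_of // => cm.
have mn := closes_lt Xc cm.
by have := @closes_word_of X (Ordinal mn) cm; rewrite (tnth_nth ord0).
Qed.

Lemma tokens_word_of X : compatible X -> tokens (word_of X) = X.
Proof.
move=> Xc; apply/setP=> -[j a]; rewrite inE /= mem_word_of // parity_word_of //.
have [/closes_word_of->|_] := boolP (closes X j); rewrite ?implybT //.
by rewrite eq_sym; case: eqP => //= _; rewrite implybF; case: eqP.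
Qed.

Lemma closes_tokens w m : is_pell_string w -> closes (tokens w) m = parity w m.
Proof.
move=> /(pell_parityP k_gt0) wP; case: m => [|m]; first by rewrite parity0 closes0.
have [mn|nm] := ltnP m n; last first.
  rewrite closes_ge; last lia.
  apply/esym/negbTE/negP=> /wP/(nth_max_lt k_gt0).
  by rewrite size_tuple; lia.
have [j ->] : exists j : 'I_n, m = j by exists (Ordinal mn).
rewrite closesS inE /= eqxx [ord_max == _]eq_sym ord0_max /= (tnth_nth ord0) parityS //.
have := wP j; case: (parity w j) => [->//|_]; rewrite ?eqxx //.
by rewrite andbT.
Qed.

Lemma compatible_tokens w : is_pell_string w -> compatible (tokens w).
Proof.
move=> wP; have par := closes_tokens _ wP; split.
- by move=> j a; rewrite inE => /and3P[].
- by move=> j a b; rewrite !inE /= => /and3P[/eqP<- _ _] /and3P[/eqP<-].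
- move=> j; rewrite -closesS par => /(pell_parity_max k_gt0 wP)/(nth_max_lt k_gt0).
  by rewrite size_tuple.
- move=> j a; rewrite inE par => /and3P[/= /eqP<- _]; rewrite (tnth_nth ord0).
  apply: contraTN => pj; rewrite pj.
  by rewrite (pell_parity_max k_gt0 wP pj) eqxx.
Qed.

Lemma tokensK w : is_pell_string w -> word_of (tokens w) = w.
Proof.
move=> wP; apply: eq_from_tnth => j; rewrite tnth_mktuple closes_tokens //.
have [/(pell_parity_max k_gt0 wP)|pj] := boolP (parity w j).
  by rewrite (tnth_nth ord0).
case: pickP => [a|no]; first by rewrite inE /= => /and3P[/eqP<-].
by move: (no (tnth w j)); rewrite inE /= eqxx pj implybT andbT => /negbFE/eqP.
Qed.

(** * Zeros as uncovered positions, and adjacency as the addition of one token *)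

Lemma tnth_eq0 w (j : 'I_n) : is_pell_string w ->
  reflect (~~ closes (tokens w) j /\ forall a, (j, a) \notin tokens w) (tnth w j == ord0).
Proof.
move=> wP; apply: (iffP eqP) => [wj|[cj wj]]; last first.
  by rewrite -(tokensK wP) word_of_eq0.
split; last first.
  by move=> a; rewrite inE /= wj; case: eqP => //= <-.
rewrite closes_tokens //; apply/negP=> /(pell_parity_max k_gt0 wP)/eqP.
by rewrite -tnth_nth wj ord0_max.
Qed.

(** Replacing a letter changes no parity and adds its token. Replacing a pair changes the parity
    only at [j'], between the two new letters k, and adds the block token at [j]. *)
Lemma replacement_tokens w w' : is_pell_string w -> is_pell_string w' ->
  replacement w w' -> exists2 t, t \notin tokens w & tokens w' = t |: tokens w.
Proof.
move=> wP w'P /orP[/existsP[j /and3P[wj w'j /forallP ww']]|].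
  exists (j, tnth w' j); first by case: (tnth_eq0 j wP wj).
  have w'j0 : tnth w' j != ord0 by rewrite -val_eqE /=; lia.
  have w'jm : tnth w' j != ord_max by rewrite -val_eqE /=; lia.
  have {}ww' l : l != j -> tnth w' l = tnth w l by have := ww' l; case: eqP => //= _ /eqP.
  have par m : parity w' m = parity w m.
    elim: m => [|m IH]; first by rewrite !parity0.
    rewrite !parityS // IH; congr (_ (+) _).
    have [mn|nm] := ltnP m n; last by rewrite !nth_default ?size_tuple.
    rewrite -!(tnth_nth ord0 _ (Ordinal mn)).
    have [->|/ww'->//] := eqVneq (Ordinal mn) j.
    by rewrite (negPf w'jm) (eqP wj) ord0_max.
  apply/setP=> -[l a]; rewrite !inE /= par xpair_eqE.
  have [->|/ww'->//] := eqVneq l j.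
  rewrite (eqP wj) /= [ord0 == a]eq_sym; have [->|_] /= := eqVneq a ord0.
    by rewrite [ord0 == _]eq_sym (negPf w'j0).
  rewrite orbF eq_sym; have [->|//] := eqVneq a (tnth w' j).
  by rewrite (negPf w'jm).
case/existsP=> j /existsP[j' /and5P[/eqP jj' wj wj' w'j /andP[w'j' /forallP ww']]].
exists (j, ord_max); first by case: (tnth_eq0 j wP wj).
have {}ww' l : l != j -> l != j' -> tnth w' l = tnth w l.
  by move=> lj lj'; have := ww' l; rewrite lj lj' => /eqP.
have par m : parity w' m = parity w m (+) (m == j').
  elim: m => [|m IH]; first by rewrite !parity0 jj'.
  rewrite !parityS // IH jj' eqSS.
  have [mn|nm] := ltnP m n; last first.
    by rewrite !nth_default ?size_tuple // ord0_max; have := ltn_ord j; have := ltn_ord j'; lia.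
  rewrite -!(tnth_nth ord0 _ (Ordinal mn)).
  have [e|nej] := eqVneq (Ordinal mn) j.
    rewrite e (eqP wj) (eqP w'j) ord0_max eqxx -e /= eqxx.
    by rewrite (_ : (m == m.+1) = false) ?addbF //; lia.
  have [e|nej'] := eqVneq (Ordinal mn) j'.
    rewrite e (eqP wj') (eqP w'j') ord0_max eqxx -jj' -e /= eqxx.
    have -> : (m == j) = false by move/(congr1 val): e => /=; lia.
    by case: (parity w m).
  rewrite ww' //; have -> : (m == j.+1) = false.
    by rewrite -jj'; move: nej'; rewrite -val_eqE => /negPf.
  move: nej; rewrite -val_eqE /= => /negPf->.
  by rewrite !addbF.
have pj0 l : tnth w l == ord0 -> parity w l = false.
  by move=> /(tnth_eq0 l wP)[/negPf <- _]; rewrite closes_tokens.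
apply/setP=> -[l a]; rewrite !inE /= par xpair_eqE.
have [->|lj] /= := eqVneq l j.
  rewrite (pj0 _ wj) (eqP wj) (eqP w'j) (_ : (j == j' :> nat) = false); last lia.
  rewrite /= implybT andbT; have [<-|am] := eqVneq ord_max a.
    by rewrite eq_sym ord0_max.
  by rewrite /= eq_sym; case: eqP.
(* The second new k sits at odd parity, hence yields no token. *)
have [->|lj'] := eqVneq l j'.
  rewrite (pj0 _ wj') (eqP wj') (eqP w'j') eqxx /=.
  have [<-|_] /= := eqVneq ord_max a; first by rewrite ord0_max ?andbF.
  by rewrite eq_sym; case: eqP.
rewrite ww' // (_ : (l == j' :> nat) = false) ?addbF //.
exact/negbTE.
Qed.

(** Compatibility of [tokens w'] makes the positions of the new piece uncovered in [w], hence zeros;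
    its letter decides which replacement applies. *)
Lemma tokens_replacement w w' t : is_pell_string w -> is_pell_string w' ->
  t \notin tokens w -> tokens w' = t |: tokens w -> replacement w w'.
Proof.
case: t => j a wP w'P tw ew'.
have [w'0 w'U w'n w'c] := compatible_tokens w'P.
have sub : tokens w \subset tokens w' by rewrite ew' subsetUr.
have tw' : (j, a) \in tokens w' by rewrite ew' setU11.
have wj : tnth w j == ord0.
  apply/tnth_eq0 => //; split.
    by apply: contra (w'c _ _ tw'); apply: closes_sub.
  move=> b; apply/negP=> bw; move/negP: tw; apply.
  by rewrite (w'U _ _ _ tw' (subsetP sub _ bw)).
have w'j : tnth w' j = a by move: tw'; rewrite inE => /and3P[/eqP].
(* Away from [j] the words can differ only where [closes] does. *)
have pickE (l : 'I_n) : l != j -> closes (tokens w') l = closes (tokens w) l ->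
    tnth w' l = tnth w l.
  move=> lj cl; rewrite -(tokensK wP) -(tokensK w'P) !tnth_mktuple cl.
  congr (if _ then _ else odflt _ _); apply: eq_pick => b.
  by rewrite ew' !inE xpair_eqE (negPf lj).
have a0 := w'0 _ _ tw'.
have [am|am] := eqVneq a ord_max; last first.
  apply/orP; left; apply/existsP; exists j; rewrite wj w'j /=; apply/andP; split.
    have := ltn_ord a; move: a0 am; rewrite -!val_eqE /=; lia.
  apply/forallP=> l; apply/implyP=> lj; apply/eqP/pickE => //.
  rewrite /closes; apply: eq_existsb => i; rewrite ew' in_setU1 xpair_eqE.
  by rewrite [ord_max == _]eq_sym (negPf am) andbF.
apply/orP; right; rewrite am in tw' tw ew' w'j.
have jn := w'n _ tw'; pose j' := Ordinal jn.
have cw' : closes (tokens w') j' by rewrite closesS.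
apply/existsP; exists j; apply/existsP; exists j'.
rewrite eqxx wj w'j eqxx /=; apply/and3P; split.
- apply/tnth_eq0 => //; split; first by rewrite closesS.
  by move=> b; apply: contraL cw' => bw; apply: (w'c _ b); apply: (subsetP sub).
- by rewrite -(tokensK w'P) closes_word_of.
- apply/forallP=> l; apply/implyP=> /andP[lj lj']; apply/eqP/pickE => //.
  rewrite /closes; apply: eq_existsb => i; rewrite ew' in_setU1 xpair_eqE eqxx andbT.
  have [->|//] := eqVneq i j; have [e|//] := eqVneq j.+1 (l : nat).
  by case/eqP: lj'; apply: val_inj.
Qed.

Lemma tokens_val_inj : injective (fun v => tokens (val v)).
Proof.
move=> u v e; apply: val_inj.
by rewrite -(tokensK (valP u)) e tokensK //; apply: valP.
Qed.

Lemma tokens_val_onto X : compatible X -> exists v : munarini n k, tokens (val v) = X.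
Proof. by move=> Xc; exists (Sub _ (pell_word_of Xc)); rewrite SubK tokens_word_of. Qed.

Lemma tokens_val_down v X : X \subset tokens (val v) ->
  exists u : munarini n k, tokens (val u) = X.
Proof.
by move=> sub; apply: tokens_val_onto; apply: compatible_sub sub (compatible_tokens (valP v)).
Qed.

Lemma sedge_munariniE u v : sedge u v =
  (#|(tokens (val u) :\: tokens (val v)) :|: (tokens (val v) :\: tokens (val u))| == 1).
Proof.
have one (A B : {set token}) t : t \notin A -> B = t |: A ->
    (A :\: B) :|: (B :\: A) = [set t].
  move=> tA ->; apply/setP=> s; rewrite !inE.
  by have [->|_] := eqVneq s t; [rewrite (negPf tA)|case: (s \in A)].
rewrite /= /munarini_adj; apply/andP/cards1P => [[_ /orP[]]|[t e]].
- by case/(replacement_tokens (valP u) (valP v))=> t tu ev; exists t; apply: one.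
- case/(replacement_tokens (valP v) (valP u))=> t tu ev; exists t.
  by rewrite setUC; apply: one.
split.
  by apply/eqP=> uv; move/setP/(_ t): e; rewrite uv setDv setU0 in_set0 set11.
have eU (A B : {set token}) : (A :\: B) :|: (B :\: A) = [set t] -> t \notin A -> B = t |: A.
  move=> /setP E tA; apply/setP=> s; move: (E s); rewrite !inE.
  have [->|_] := eqVneq s t; first by rewrite (negPf tA); case: (t \in B).
  by case: (s \in A); case: (s \in B).
apply/orP; have [tu|tu] := boolP (t \in tokens (val u)); [right|left].
  have tv : t \notin tokens (val v).
    by move/setP/(_ t): e; rewrite in_setU !in_setD in_set1 eqxx tu; case: (t \in tokens (val v)).
  apply: (tokens_replacement (valP v) (valP u) tv); apply: eU => //.
  by rewrite setUC.
exact: (tokens_replacement (valP u) (valP v) tu (eU _ _ e tu)).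
Qed.

(** A zero leaves room for one more letter token, whereas in a zero-free string every position is
    covered and no compatible token can be added. *)
Lemma facet_munarini v :
  facet (fun u : munarini n k => tokens (val u)) v = (ord0 \notin val v).
Proof.
have vP := valP v; have [v0 vU vn vc] := compatible_tokens vP.
apply/forallP/idP => [vmax|v_full u].
  apply/negP=> /tnthP[j /esym/eqP/(tnth_eq0 j vP)[cj vj]].
  (* The letter 1 differs from 0 and from k because [1 < k]; it opens no block, so [closes] is
     unchanged. *)
  have lt1 : 1 < k.+1 by lia.
  pose a := Ordinal lt1; have am : a != ord_max by rewrite -val_eqE /=; lia.
  pose X := (j, a) |: tokens (val v).
  have closesX m : closes X m = closes (tokens (val v)) m.
    apply: eq_existsb => i; rewrite in_setU1 xpair_eqE.
    by rewrite [ord_max == _]eq_sym (negPf am) andbF.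
  have [] := @tokens_val_onto X; first split.
  - by move=> i b; rewrite in_setU1 => /predU1P[[_ ->]|/v0].
  - move=> i b c; rewrite !in_setU1 !xpair_eqE.
    case/orP=> [/andP[/eqP-> /eqP->]|ib] /orP[/andP[/eqP e /eqP->]|ic] //.
    + by case/negP: (vj c).
    + by case/negP: (vj b); rewrite -e.
    + by apply: (vU i b c).
  - move=> i; rewrite in_setU1 xpair_eqE [ord_max == _]eq_sym (negPf am) andbF.
    exact: vn.
  - by move=> i b; rewrite in_setU1 closesX => /predU1P[[-> _]|/vc].
  move=> u eu; have := vmax u; rewrite eu subsetUr => /eqP uv.
  by case/negP: (vj a); rewrite -uv eu setU11.
apply/implyP=> vu; have [u0 uU un uc] := compatible_tokens (valP u).
apply/eqP/esym/tokens_val_inj/eqP; rewrite eqEsubset vu /=.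
apply/subsetP=> -[j a] ja.
have cj : ~~ closes (tokens (val v)) j.
  by apply: contra (uc _ _ ja); apply: closes_sub.
have [[b jb]|no] : (exists b, (j, b) \in tokens (val v)) \/ forall b, (j, b) \notin tokens (val v).
  have [/existsP|/existsPn] := boolP [exists b, (j, b) \in tokens (val v)]; by [left|right].
  by rewrite (uU _ _ _ ja (subsetP vu _ jb)).
case/negP: v_full; rewrite (_ : ord0 = tnth (val v) j) ?mem_tnth //.
by apply/esym/eqP/tnth_eq0.
Qed.

(** A position starts at most one piece, so tokens can be counted by position. *)
Lemma card_tokens w : #|tokens w| = rank_from false w.
Proof.
rewrite rank_fromE size_tuple.
pose P j := (tnth w j != ord0) && ((tnth w j == ord_max) ==> ~~ parity w j).
have -> : tokens w = [set (j, tnth w j) | j in P].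
  apply/setP=> -[j a]; rewrite inE /=; apply/andP/imsetP => [[/eqP<- wj]|].
    by exists j.
  by case=> i iP [-> ->].
rewrite card_imset; last by move=> i j [].
rewrite -sum1_card big_mkcond; apply: eq_bigr => j _.
by rewrite -(tnth_nth ord0) unfold_in -/(P j); case: (P j).
Qed.

Lemma card_facets p :
  #|[set v : munarini n k | (ord0 \notin val v) && (#|tokens (val v)| == p)]| =
  size (full_words k p n).
Proof.
rewrite cardE -(size_map (fun v : munarini n k => tval (val v))).
apply/perm_size/uniq_perm.
- by rewrite map_inj_uniq ?enum_uniq // => u v /val_inj/val_inj.
- exact: full_words_uniq.
move=> s; rewrite mem_full_words //; apply/mapP/and4P => [[v]|[sn sP s0 sp]].
  rewrite mem_enum inE card_tokens => /andP[v0 vp] ->; rewrite size_tuple; split=> //.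
  by apply/pell_fromP => // m; apply: (pell_parity_max k_gt0 (valP v)).
have wP : is_pell_string (Tuple sn).
  by apply/pell_parityP => // m; move/(pell_fromP k_gt0): sP; apply.
exists (Sub (Tuple sn) wP : munarini n k); rewrite ?SubK //.
by rewrite mem_enum inE SubK card_tokens s0.
Qed.

End Tokens.

Theorem corollary4p12 (n k p : nat) (hk : 2 <= k) :
  num_maximal_hypercubes (munarini n k) p =
  (k - 1) ^ (2 * p - n) * binz p (n%:Z - p%:Z)%R.
Proof.
rewrite (num_maximal_hypercubesE (@tokens_val_inj n k hk) (@tokens_val_down n k hk)
  (@sedge_munariniE n k hk)).
have eF : [set v | facet (fun u : munarini n k => tokens (val u)) v & #|tokens (val v)| == p]
  = [set v : munarini n k | (ord0 \notin val v) && (#|tokens (val v)| == p)].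
  by apply/setP=> v; rewrite !in_set facet_munarini.
rewrite eF card_facets // size_full_words ?(ltnW hk) //.
case: leqP => pn; last first.
  (* [Negz m] stands for [- m.+1], hence the predecessor. *)
  by rewrite (_ : (_ - _)%R = Negz (p - n).-1) ?muln0 //; lia.
by rewrite (_ : (_ - _)%R = Posz (n - p)) //; lia.
Qed.
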